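(* Let $q\ge 1$ and let $C\subseteq S^q$ be a nonzero convolutional code (that is, a nonzero $S$-submodule of $S^q$). Then $C$ has a minimal reduced polynomial resolution: there exists a minimal reduced polynomial resolution $(G_l,\ldots,G_1)$ with $\mathrm{Im}(G_1)=C$.
   Context: Setting. $\mathbb F$ is an arbitrary field, $n\ge 1$ an integer, $D=(D_1,\ldots,D_n)$ indeterminates, $S=\mathbb F[D]$. $S_{\le d}$ is the space of polynomials of (total) degree $\le d$ ($d\in\mathbb Z$). A convolutional code of length $q$ is a submodule of $S^q$. All polynomial matrices considered are assumed to have no zero column. Degrees. A twisting (degree) function of length $p$ is a function $a:[1,p]=\{1,\ldots,p\}\to\mathbb Z_+=\{0,1,2,\ldots\}$. For $f\in S^p$, $\deg_a(f)=\max_i\{a(i)+\deg(f_i)\}$ (and $-\infty$ if $f=0$). For $G\in S^{p\times q}$ with no zero column, $\deg_a(G):[1,q]\to\mathbb Z_+$ sends $j$ to the $a$-degree of the $j$-th column of $G$. Polynomial complexes. A polynomial complex of length $l\ge 1$ and size $q\times(p_l,\ldots,p_1)$ ($p_i\geq 1$) is a sequence $(G_l,\ldots,G_1)$ of matrices over $S$, where $G_1$ is $q\times p_1$ and $G_i$ is $p_{i-1}\times p_i$ for $i\ge2$, such that $G_1G_2=0,\ldots,G_{l-1}G_l=0$. It is a polynomial resolution if $0\to S^{p_l}\xrightarrow{G_l}\cdots\to S^{p_1}\xrightarrow{G_1}S^q$ is exact (at every term except $S^q$); it is a polynomial resolution of $C$ if moreover $\mathrm{Im}(G_1)=C$. Its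 column degree table $(a_l,\ldots,a_1)$ is defined recursively by $a_0=0$ (the zero function on $[1,q]$; put $p_0=q$) and $a_{i+1}=\deg_{a_i}(G_{i+1})$. Reducedness. For a polynomial complex $G$, let $G_k^L$ be the matrix over $S$ of the same size as $G_k$ whose $(i,j)$ entry is the homogeneous part of degree $a_k(j)-a_{k-1}(i)$ of the $(i,j)$ entry of $G_k$ (zero if this number is negative). $G$ is (column) reduced if the sequence $0\to S^{p_l}\xrightarrow{G_l^L}\cdots\xrightarrow{G_2^L}S^{p_1}\xrightarrow{G_1^L}S^q$ is exact (at every term except $S^q$). Filtered modules. A filtration on an $S$-module $M$ is an ascending chain $M_{\le0}\subseteq M_{\le1}\subseteq\cdots$ of $\mathbb F$-subspaces with $M=\bigcup_d M_{\le d}$ and $D_kM_{\le d}\subseteq M_{\le d+1}$ for all $k,d$; put $M_{\le -1}=0$. A homomorphism of filtered modules is an $S$-homomorphism $u:M\to N$ with $u(M_{\le d})\subseteq N_{\le d}$ for all $d\geq 0$. $S^p[-a]$ denotes $S^p$ with the filtration $S^p[-a]_{\le d}=\{f\in S^p:\deg_a(f)\le d\}$; submodules carry the induced filtration (intersection), and $C[0]$ denotes $C\subseteq S^q$ with $C_{\le d}=C\cap(S_{\le d})^q$. For a filtered module $M$ and $d\ge0$, $\Gamma_d(M)=M_{\le d}/(M_{\le d-1}+D_1M_{\le d-1}+\cdots+D_nM_{\le d-1})$. A homomorphism $u:M\to N$ of filtered modules is minimal if for every $d\ge0$ the map $u:M_{\le d}\to N_{\le d}$ is surjective and the induced map $\Gamma_d(u):\Gamma_d(M)\to\Gamma_d(N)$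 is bijective. Minimal resolutions. A reduced polynomial resolution $G=(G_l,\ldots,G_1)$ with $C=\mathrm{Im}(G_1)$ is minimal if, in the sequence of filtered modules $0\to S^{p_l}[-a_l]\xrightarrow{G_l}\cdots\xrightarrow{G_2}S^{p_1}[-a_1]\xrightarrow{G_1}C[0]\to0$, the homomorphism $G_1:S^{p_1}[-a_1]\to C[0]$ is minimal and, for each $2\le i\le l$, the homomorphism $G_i:S^{p_i}[-a_i]\to\ker(G_{i-1})$ is minimal, where $\ker(G_{i-1})\subseteq S^{p_{i-1}}$ has the filtration induced from $S^{p_{i-1}}[-a_{i-1}]$. *)

(* Defs.v *)
From HB Require Import structures.
From mathcomp Require Import all_boot all_order all_algebra.
From mathcomp Require Import boolp classical_sets functions.
From mathcomp.multinomials Require Import mpoly.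

Set Implicit Arguments.
Unset Strict Implicit.
Unset Printing Implicit Defensive.

Import GRing.Theory.
Local Open Scope ring_scope.
Local Open Scope classical_set_scope.
Local Obligation Tactic := idtac.

Definition submodule (R : nzRingType) (V : lmodType R) (C : set V) : Prop :=
  [/\ C 0, forall x y, C x -> C y -> C (x + y) & forall a x, C x -> C (a *: x)].

(* A filtered module, presented inside an ambient module V.  The conventional
   M_{<= -1} = 0 enters in fm_pred below. *)
Record filtmod (F : fieldType) (n : nat) (V : lmodType {mpoly F[n]}) := Filtmod {
  fm_car : set V;
  fm_le : nat -> set V;
  fm_submodule : submodule fm_car;
  fm_le0 : forall d, fm_le d 0;
  fm_leD : forall d x y, fm_le d x -> fm_le d y -> fm_le d (x + y);
  fm_leZ : forall d (c : F) x, fm_le d x -> fm_le d (c%:MP *: x);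
  fm_leS : forall d, fm_le d `<=` fm_le d.+1;
  fm_cover : fm_car = \bigcup_d fm_le d;
  fm_leX : forall d (k : 'I_n) x, fm_le d x -> fm_le d.+1 ('X_k *: x)
}.

Section FilteredHom.
Context (F : fieldType) (n : nat).
Implicit Types V W : lmodType {mpoly F[n]}.

(* M_{<= d-1} + D_1 M_{<= d-1} + ... + D_n M_{<= d-1} *)
Definition fm_pred V (M : filtmod V) (d : nat) : set V :=
  if d is d'.+1 then
    [set x | exists (y : V) (z : 'I_n -> V),
       [/\ fm_le M d' y, forall k, fm_le M d' (z k)
         & x = y + \sum_(k < n) 'X_k *: z k]]
  else [set 0].

(* The quotient Gamma_d(M), as the set of cosets x + fm_pred M d. *)
Definition Gamma V (M : filtmod V) (d : nat) : set (set V) :=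
  [set [set x + r | r in fm_pred M d] | x in fm_le M d].

(* Gamma_d(u) sends the coset x + fm_pred M d to u x + fm_pred N d, which is
   the sumset u(x + fm_pred M d) + fm_pred N d. *)
Definition Gamma_map V W (u : V -> W) (N : filtmod W) (d : nat)
    (A : set V) : set W :=
  [set u x + r | x in A & r in fm_pred N d].

Definition filtered_hom V W (M : filtmod V) (N : filtmod W) (u : V -> W) : Prop :=
  [/\ forall x, fm_car M x -> fm_car N (u x),
      forall x y, fm_car M x -> fm_car M y -> u (x + y) = u x + u y,
      forall a x, fm_car M x -> u (a *: x) = a *: u x
    & forall d x, fm_le M d x -> fm_le N d (u x)].

Definition minimal_hom V W (M : filtmod V) (N : filtmod W) (u : V -> W) : Prop :=
  filtered_hom M N u /\
  forall d, set_surj (fm_le M d) (fm_le N d) u /\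
            set_bij (Gamma M d) (Gamma N d) (Gamma_map u N d).

Program Definition fm_induced V (M : filtmod V) (C : set V)
    (Csub : submodule C) : filtmod V :=
  @Filtmod F n V (C `&` fm_car M) (fun d => C `&` fm_le M d) _ _ _ _ _ _ _.
Next Obligation.
move=> V M C [C0 CD CZ]; have [M0 MD MZ] := fm_submodule M.
by split=> [|x y [? ?] [? ?]|a x [? ?]]; split; auto.
Qed.
Next Obligation. by move=> V M C [C0 CD CZ] d; split=> //; apply: fm_le0. Qed.
Next Obligation.
move=> V M C [C0 CD CZ] d x y [? ?] [? ?].
by split; [exact: CD|exact: fm_leD].
Qed.
Next Obligation.
move=> V M C [C0 CD CZ] d c x [? ?]; split; [exact: CZ|exact: fm_leZ].
Qed.
Next Obligation. by move=> V M C Csub d x [? ?]; split=> //; apply: fm_leS. Qed.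
Next Obligation. by move=> V M C Csub; rewrite (fm_cover M) setI_bigcupr. Qed.
Next Obligation.
move=> V M C [C0 CD CZ] d k x [? ?]; split; [exact: CZ|exact: fm_leX].
Qed.

End FilteredHom.

Section Twist.
Context (F : fieldType) (n : nat).
Local Notation S := {mpoly F[n]}.

(* deg_a f for f <> 0, as msize is the total degree plus one.  For f = 0 the
   value is 0 instead of -oo; it is only ever compared with natural numbers or
   taken on nonzero columns. *)
Definition wdeg p (a : 'I_p -> nat) (f : 'cV[S]_p) : nat :=
  \max_(i < p | (f i 0 != 0)%R) (a i + (msize (f i 0%R)).-1)%N.

Definition coldeg p r (a : 'I_p -> nat) (G : 'M[S]_(p, r)) : 'I_r -> nat :=
  fun j => wdeg a (col j G).

Definition lead_mx p r (a : 'I_p -> nat) (b : 'I_r -> nat) (G : 'M[S]_(p, r)) :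
    'M[S]_(p, r) :=
  \matrix_(i, j) if (a i <= b j)%N then pihomog mdeg (b j - a i) (G i j) else 0.

Definition ker_mx p r (G : 'M[S]_(p, r)) : set 'cV[S]_r := [set x | G *m x = 0].

Definition im_mx p r (G : 'M[S]_(p, r)) : set 'cV[S]_p :=
  [set G *m x | x in [set: 'cV[S]_r]].

Lemma submodule_ker p r (G : 'M[S]_(p, r)) : submodule (ker_mx G).
Proof.
split=> [|x y|a x]; rewrite /ker_mx /= ?mulmx0 //.
  by move=> hx hy; rewrite mulmxDr hx hy addr0.
by move=> hx; rewrite -scalemxAr hx scaler0.
Qed.

Lemma submodule_im p r (G : 'M[S]_(p, r)) : submodule (im_mx G).
Proof.
split=> [|x y [u _ <-] [v _ <-]|a x [u _ <-]].
- by exists 0; rewrite ?mulmx0.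
- by exists (u + v); rewrite ?mulmxDr.
- by exists (a *: u); rewrite -?scalemxAr.
Qed.

Lemma wdeg_leP p (a : 'I_p -> nat) (f : 'cV[S]_p) d :
  (wdeg a f <= d)%N <->
  forall i, f i 0 != 0 -> (a i + (msize (f i 0%R)).-1 <= d)%N.
Proof. by split=> [/bigmax_leqP h i|h]; [apply: h|apply/bigmax_leqP]. Qed.

(* S^p[-a] *)
Program Definition fm_free p (a : 'I_p -> nat) : filtmod 'cV[S]_p :=
  @Filtmod F n _ setT (fun d => [set f | (wdeg a f <= d)%N]) _ _ _ _ _ _ _.
Next Obligation. by []. Qed.
Next Obligation. by move=> p a d /=; apply/wdeg_leP=> i; rewrite mxE eqxx. Qed.
Next Obligation.
move=> p a d x y /= /wdeg_leP hx /wdeg_leP hy; apply/wdeg_leP=> i; rewrite mxE.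
have := msizeD_le (x i 0) (y i 0).
have [->|/hx {}hx] := eqVneq (x i 0) 0; first by rewrite add0r => _ /hy.
have [->|/hy {}hy] := eqVneq (y i 0) 0; first by rewrite addr0.
rewrite leq_max => /orP[] le_xy _; [apply: leq_trans hx|apply: leq_trans hy];
  by rewrite leq_add2l -!subn1 leq_sub2r.
Qed.
Next Obligation.
move=> p a d c x /= /wdeg_leP hx; apply/wdeg_leP=> i; rewrite mxE mul_mpolyC.
have [->|c0] := eqVneq c 0; first by rewrite scale0r eqxx.
by rewrite msizeZ // => cx0; apply: hx; apply: contraNneq cx0 => ->; rewrite scaler0.
Qed.
Next Obligation. by move=> p a d x /= /leqW. Qed.
Next Obligation.
by move=> p a; apply/seteqP; split=> // x _; exists (wdeg a x) => /=.
Qed.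
Next Obligation.
move=> p a d k x /= /wdeg_leP hx; apply/wdeg_leP=> i; rewrite mxE.
have [->|x0 _] := eqVneq (x i 0) 0; first by rewrite mulr0 eqxx.
have X0 : ('X_k : S) != 0 by rewrite -msize_poly_eq0 msizeX mdeg1.
rewrite msizeM // msizeX mdeg1; move: (hx i x0); rewrite -msize_poly_eq0 in x0.
by case: (msize (x i 0)) x0 => // m _ /= am; rewrite add0n addnS ltnS.
Qed.

End Twist.

Section Complexes.
Context (F : fieldType) (n q : nat).
Local Notation S := {mpoly F[n]}.

Definition rank_at (p : nat -> nat) (k : nat) : nat := if k is _.+1 then p k else q.

(* pc_mat k is G_{k+1}, for 0 <= k < pc_len; the sizes p_k for k = 0 or
   k > pc_len, and the matrices pc_mat k for k >= pc_len, are irrelevant. *)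
Record polycomplex := Polycomplex {
  pc_len : nat;
  pc_size : nat -> nat;
  pc_mat : forall k, 'M[S]_(rank_at pc_size k, rank_at pc_size k.+1);
  pc_len_gt0 : (0 < pc_len)%N;
  pc_size_gt0 : forall k, (0 < k <= pc_len)%N -> (0 < pc_size k)%N;
  pc_col_neq0 : forall k, (k < pc_len)%N -> forall j, col j (pc_mat k) != 0;
  pc_mul0 : forall k, (k.+1 < pc_len)%N -> pc_mat k *m pc_mat k.+1 = 0
}.

Local Notation rk G := (rank_at (pc_size G)).

(* Exactness of 0 -> S^(p_l) -> ... -> S^(p_1) -> S^q at S^(p_l), ..., S^(p_1). *)
Definition exact_seq (l : nat) (p : nat -> nat)
    (M : forall k, 'M[S]_(rank_at p k, rank_at p k.+1)) : Prop :=
  forall k, (k < l)%N ->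
    ker_mx (M k) = if (k.+1 < l)%N then im_mx (M k.+1) else [set 0].

Fixpoint col_table (G : polycomplex) (k : nat) : 'I_(rk G k) -> nat :=
  if k is k'.+1 then coldeg (@col_table G k') (pc_mat G k') else fun=> 0%N.

Definition resolution (G : polycomplex) : Prop := exact_seq (pc_len G) (pc_mat G).

Definition resolution_of (G : polycomplex) (C : set 'cV[S]_q) : Prop :=
  resolution G /\ im_mx (pc_mat G 0%N) = C.

Definition pc_lead (G : polycomplex) (k : nat) : 'M[S]_(rk G k, rk G k.+1) :=
  lead_mx (@col_table G k) (@col_table G k.+1) (pc_mat G k).

Definition reduced (G : polycomplex) : Prop := exact_seq (pc_len G) (pc_lead G).

(* S^(p_k)[-a_k]; for k = 0 this is S^q[0]. *)
Definition pc_free (G : polycomplex) (k : nat) : filtmod 'cV[S]_(rk G k) :=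
  fm_free F n (@col_table G k).

(* C[0] is pc_free G 0 restricted to C = Im(G_1). *)
Definition minimal (G : polycomplex) : Prop :=
  minimal_hom (pc_free G 1)
    (fm_induced (pc_free G 0) (submodule_im (pc_mat G 0%N)))
    (mulmx (pc_mat G 0%N)) /\
  forall k, (k.+1 < pc_len G)%N ->
    minimal_hom (pc_free G k.+2)
      (fm_induced (pc_free G k.+1) (submodule_ker (pc_mat G k)))
      (mulmx (pc_mat G k.+1)).

End Complexes.

(* Main.v *)
(* Passing to leading forms turns the claim into Hilbert's syzygy theorem for
   graded modules.  In every module [K] of syzygies, choose generators whose
   leading terms are not leading terms of
   [K_(<= d-1) + D_1 K_(<= d-1) + ... + D_n K_(<= d-1)].  Such terms form an
   antichain, so there are finitely many (Dickson), and the chosen elements of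
   degree [d] form a basis of [Gamma_d(K)].  The resulting maps are strict, which
   makes the sequence of leading matrices exact, and minimality says that its
   entries have no constant term.  Setting the indeterminates to [0] one at a time
   loses exactness at one place each; once all of them are [0], the sequence is
   exact from place [n] on with zero maps, so the ranks vanish there. *)

From HB Require Import structures.
Require Import Defs.
From mathcomp Require Import all_boot all_order all_algebra.
From mathcomp Require Import boolp classical_sets functions cardinality.
From mathcomp.multinomials Require Import mpoly.

Set Implicit Arguments.
Unset Strict Implicit.
Unset Printing Implicit Defensive.

Import Order.TTheory GRing.Theory.
Local Open Scope ring_scope.
Local Open Scope classical_set_scope.

(** * Polynomials and their supports *)

Section Support.
Context (F : fieldType) (n : nat).
Local Notation S := {mpoly F[n]}.
Implicit Types (p r : nat) (f g : S) (m u : 'X_{1..n}).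

Lemma mcoeffM_neq0 f g m : (f * g)@_m != 0 ->
  exists u v : 'X_{1..n}, [/\ m = (u + v)%MM, f@_u != 0 & g@_v != 0].
Proof.
rewrite -mcoeff_msupp => /msuppM_le/allpairsP[[u v] /= [hu hv ->]].
by exists u, v; rewrite -!mcoeff_msupp.
Qed.

Lemma mcoeff_sum_neq0 (I : finType) (P : pred I) (f : I -> S) m :
  (\sum_(i | P i) f i)@_m != 0 -> exists2 i, P i & (f i)@_m != 0.
Proof.
rewrite raddf_sum /= => h; apply: contrapT => /forall2NP hN; case/negP: h.
apply/eqP/big1 => i Pi; apply/eqP/negPn/negP.
by case: (hN i).
Qed.

Lemma mcoeff_mulmx_neq0 p r s (A : 'M[S]_(p, r)) (B : 'M[S]_(r, s)) i k m :
  ((A *m B) i k)@_m != 0 -> exists (j : 'I_r) (u v : 'X_{1..n}),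
    [/\ m = (u + v)%MM, (A i j)@_u != 0 & (B j k)@_v != 0].
Proof.
by rewrite mxE => /mcoeff_sum_neq0[j _ /mcoeffM_neq0[u [v h]]]; exists j, u, v.
Qed.

Lemma mcoeff_pihomog d f m :
  (pihomog mdeg d f)@_m = if mdeg m == d then f@_m else 0.
Proof.
rewrite /pihomog raddf_sum /= (eq_bigr (fun u => f@_u * (u == m)%:R)); last first.
  by move=> u _; rewrite mcoeffZ mcoeffX.
have [fm|fm] := boolP (m \in msupp f); last first.
  rewrite big1_seq => [|u /andP[_ uf]]; last first.
    by case: eqP fm uf => [->/negPf->|]; rewrite ?mulr0.
  by rewrite memN_msupp_eq0 //; case: ifP.
rewrite big_mkcond (bigD1_seq m) ?msupp_uniq //= eqxx mulr1.
by rewrite big1 ?addr0 // => u /negPf->; rewrite mulr0; case: ifP.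
Qed.

Lemma mpolyX_dvd (k : 'I_n) f :
  (forall m, f@_m != 0 -> m k != 0%N) -> exists g, f = 'X_k * g.
Proof.
move=> hf; exists (\sum_(m <- msupp f) f@_m *: 'X_[m - U_(k)]).
rewrite mulr_sumr {1}[f]mpolyE; apply: eq_big_seq => m.
rewrite mcoeff_msupp => /hf mk; rewrite -scalerAr -mpolyXD addmC submK //.
by rewrite lep1mP.
Qed.

(** Its image is a copy of the quotient of [S] by the indeterminates of index below [l]. Staying
    inside [S] keeps all matrices over one ring while indeterminates are killed one by one. *)
Definition subst0 (l : nat) : S -> S :=
  comp_mpoly [tuple if (i < l)%N then 0 else 'X_i | i < n].

HB.instance Definition _ l := GRing.RMorphism.on (subst0 l).

Lemma subst0X l m : subst0 l 'X_[m] =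
  if [forall i : 'I_n, (i < l)%N ==> (m i == 0%N)] then 'X_[m] else 0.
Proof.
rewrite /subst0 comp_mpolyX; case: ifP => [/forallP h|/negbT].
  rewrite [RHS]mpolyXE_id; apply: eq_bigr => i _; rewrite tnth_mktuple.
  by case: ifP (h i) => //= _ /eqP->; rewrite !expr0.
rewrite negb_forall => /existsP[i]; rewrite negb_imply => /andP[il mi].
by rewrite (bigD1 i) //= tnth_mktuple il expr0n (negPf mi) mul0r.
Qed.

Lemma mcoeff_subst0 l f m : (subst0 l f)@_m =
  if [forall i : 'I_n, (i < l)%N ==> (m i == 0%N)] then f@_m else 0.
Proof.
rewrite [in RHS](mpolyE f) /subst0 comp_mpolyEX !raddf_sum /=.
transitivity (\sum_(u <- msupp f)
  if [forall i : 'I_n, (i < l)%N ==> (m i == 0%N)] then (f@_u *: 'X_[u])@_m else 0).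
  apply: eq_bigr => u _; rewrite -/(subst0 l 'X_[u]) subst0X.
  rewrite !mcoeffZ mcoeffX; have [->|um] := eqVneq u m.
    by case: ifP => _; rewrite ?mcoeffX ?eqxx ?mcoeff0 ?mulr0.
  by case: ifP => _; case: ifP; rewrite ?mcoeffX ?(negPf um) ?mcoeff0 ?mulr0.
by case: ifP => // _; rewrite big1.
Qed.

Lemma subst0_0 f : subst0 0 f = f.
Proof.
apply/mpolyP => m; rewrite mcoeff_subst0; case: ifP => // /negbT.
by rewrite negb_forall => /existsP[].
Qed.

Lemma subst0_n f : subst0 n f = (f@_0%MM)%:MP.
Proof.
apply/mpolyP => m; rewrite mcoeff_subst0 mcoeffC.
have [->|m0] := eqVneq m 0%MM.
  by rewrite mulr1 ifT //; apply/forallP => i; rewrite mnm0E eqxx implybT.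
rewrite mulr0 ifF //; apply: contraNF m0 => /forallP h.
by apply/eqP/mnmP => i; rewrite mnm0E; apply/eqP; have := h i; rewrite ltn_ord.
Qed.

(** The difference of the two substitutions collects the monomials that contain ['X_k] and no
    earlier indeterminate, so it is divisible by ['X_k]. The support clause ensures that degrees
    drop by one on passing to [g]. *)
Lemma subst0_S (k : 'I_n) f : exists2 g, subst0 k f = 'X_k * g + subst0 k.+1 f
  & forall m, g@_m != 0 -> f@_(m + U_(k)) != 0.
Proof.
have [m|g hg] := @mpolyX_dvd k (subst0 k f - subst0 k.+1 f).
  apply: contraNneq => mk; rewrite mcoeffB !mcoeff_subst0.
  rewrite (_ : [forall i : 'I_n, (i < k.+1)%N ==> _]
             = [forall i : 'I_n, (i < k)%N ==> (m i == 0%N)]) ?subrr //.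
  apply: eq_forallb => i; rewrite ltnS leq_eqVlt.
  by case: eqP => // /val_inj->; rewrite mk eqxx !implybT.
exists g; first by rewrite -hg subrK.
move=> m; have -> : g@_m = ('X_k * g)@_(m + U_(k)).
  by rewrite mulrC addmC mcoeffMX.
rewrite -hg mcoeffB !mcoeff_subst0; do 2!case: ifP => _; rewrite ?subr0 ?subrr ?eqxx //.
by rewrite sub0r oppr_eq0.
Qed.

Lemma subst0_idem k l f : (k <= l)%N -> subst0 l (subst0 k f) = subst0 l f.
Proof.
move=> kl; apply/mpolyP => m; rewrite !mcoeff_subst0.
case: ifP => // /forallP h; rewrite ifT //; apply/forallP => i.
by apply/implyP => ik; have := h i; rewrite (leq_trans ik).
Qed.

(** The differences [subst0 k f - subst0 k.+1 f] telescope from [f] down to its constant term. *)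
Lemma mpolyX_decomp f : exists2 g : 'I_n -> S,
  f = (f@_0%MM)%:MP + \sum_k 'X_k * g k &
  forall k m, (g k)@_m != 0 -> f@_(m + U_(k)) != 0.
Proof.
have /choice[g hg] : forall k : 'I_n, exists g,
    subst0 k f = 'X_k * g + subst0 k.+1 f /\
    forall m, g@_m != 0 -> f@_(m + U_(k)) != 0.
  by move=> k; have [g] := subst0_S k f; exists g.
exists g; last by move=> k m; apply: (hg k).2.
rewrite -subst0_n (eq_bigr (fun k : 'I_n => subst0 k f - subst0 k.+1 f)).
  rewrite -(big_mkord predT (fun k => subst0 k f - subst0 k.+1 f)).
  rewrite -(opprK (\sum_(_ <= _ < _) _)) -sumrN.
  under eq_bigr do rewrite opprB.
  by rewrite telescope_sumr // subst0_0 opprB addrC subrK.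
by move=> k _; rewrite (hg k).1 addrK.
Qed.

End Support.

(** * Filtered modules and twisted degrees *)

Section FilteredModules.
Context (F : fieldType) (n : nat).
Local Notation S := {mpoly F[n]}.
Implicit Types V W : lmodType S.

Lemma fm_leN V (M : filtmod V) d x : fm_le M d x -> fm_le M d (- x).
Proof. by move/(fm_leZ (-1)); rewrite mpolyCN mpolyC1 scaleN1r. Qed.

Lemma fm_leB V (M : filtmod V) d x y :
  fm_le M d x -> fm_le M d y -> fm_le M d (x - y).
Proof. by move=> hx /fm_leN; apply: fm_leD. Qed.

Lemma fm_le_sum V (M : filtmod V) d (I : Type) (s : seq I) (P : pred I) (f : I -> V) :
  (forall i, P i -> fm_le M d (f i)) -> fm_le M d (\sum_(i <- s | P i) f i).
Proof.
by move=> h; elim/big_ind: _ => //; [apply: fm_le0|move=> x y; apply: fm_leD].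
Qed.

Lemma fm_le_leq V (M : filtmod V) d e x : (d <= e)%N -> fm_le M d x -> fm_le M e x.
Proof.
elim: e => [|e IH]; first by rewrite leqn0 => /eqP->.
by rewrite leq_eqVlt => /predU1P[->//|]; rewrite ltnS => h /(IH h)/fm_leS.
Qed.

Lemma fm_pred_le V (M : filtmod V) d x : fm_pred M d x -> fm_le M d x.
Proof.
case: d => [->|d [y [z [hy hz ->]]]]; first exact: fm_le0.
apply: fm_leD; first exact: fm_leS.
by apply: fm_le_sum => k _; apply: fm_leX.
Qed.

Lemma fm_pred0 V (M : filtmod V) d : fm_pred M d 0.
Proof.
case: d => // d; exists 0, (fun=> 0); split; [exact: fm_le0|by move=> _; exact: fm_le0|].
by rewrite big1 ?addr0 // => k _; rewrite scaler0.
Qed.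

Lemma fm_predD V (M : filtmod V) d x y :
  fm_pred M d x -> fm_pred M d y -> fm_pred M d (x + y).
Proof.
case: d => [->->|d [u [z [hu hz ->]]] [v [w [hv hw ->]]]]; first by rewrite /= addr0.
exists (u + v), (fun k => z k + w k); split=> [|k|]; try exact: fm_leD.
by rewrite addrACA -big_split; congr (_ + _); apply: eq_bigr => k _; rewrite scalerDr.
Qed.

Lemma fm_predZ V (M : filtmod V) d c x : fm_pred M d x -> fm_pred M d (c%:MP *: x).
Proof.
case: d => [->|d [u [z [hu hz ->]]]]; first by rewrite /= scaler0.
exists (c%:MP *: u), (fun k => c%:MP *: z k); split=> [|k|]; try exact: fm_leZ.
rewrite scalerDr scaler_sumr; congr (_ + _); apply: eq_bigr => k _.
by rewrite !scalerA mulrC.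
Qed.

Lemma fm_predN V (M : filtmod V) d x : fm_pred M d x -> fm_pred M d (- x).
Proof. by move/(fm_predZ (-1)); rewrite mpolyCN mpolyC1 scaleN1r. Qed.

Lemma fm_predB V (M : filtmod V) d x y :
  fm_pred M d x -> fm_pred M d y -> fm_pred M d (x - y).
Proof. by move=> hx /fm_predN; apply: fm_predD. Qed.

Lemma fm_pred_lt V (M : filtmod V) d e x : (e < d)%N -> fm_le M e x -> fm_pred M d x.
Proof.
case: d => // d; rewrite ltnS => ed hx; exists x, (fun=> 0).
split; [exact: fm_le_leq hx|by move=> _; exact: fm_le0|].
by rewrite big1 ?addr0 // => k _; rewrite scaler0.
Qed.

Lemma fm_leXm V (M : filtmod V) d m x :
  fm_le M d x -> fm_le M (d + mdeg m) ('X_[m] *: x).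
Proof.
move: {2}(mdeg m) (erefl (mdeg m)) => e; elim: e m d x => [|e IH] m d x em hx.
  move/eqP: em; rewrite mdeg_eq0 => /eqP->.
  by rewrite mpolyX0 scale1r mdeg0 addn0.
have /existsP[k mk] : [exists k, m k != 0%N].
  apply: contra_eqT em => /existsPn h; rewrite mdegE big1 // => k _.
  by apply/eqP; rewrite -[_ == _]negbK h.
move: em; rewrite -lep1mP in mk; rewrite -(submK mk) mdegD mdeg1 addn1 => -[em].
by rewrite em addnS mpolyXD -scalerA -em -addSn; apply: IH => //; apply: fm_leX.
Qed.

(** One factor ['X_k] is split off from [m]; the remaining monomial takes [x] to degree at most
    [d + mdeg m - 1]. *)
Lemma fm_pred_Xm V (M : filtmod V) d m x : m != 0%MM ->
  fm_le M d x -> fm_pred M (d + mdeg m) ('X_[m] *: x).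
Proof.
move=> m0 hx; have /existsP[k mk] : [exists k, m k != 0%N].
  apply: contra_neqT m0 => /existsPn h; apply/mnmP => k; rewrite mnm0E.
  by apply/eqP; rewrite -[_ == _]negbK h.
rewrite -lep1mP in mk; rewrite -(submK mk) mdegD mdeg1 addn1 addnS.
exists 0, (fun l => if l == k then 'X_[m - U_(k)] *: x else 0); split.
- exact: fm_le0.
- by move=> l; case: eqP => _; [apply: fm_leXm|apply: fm_le0].
rewrite add0r (bigD1 k) //= eqxx big1 ?addr0 => [|l /negPf->]; last exact: scaler0.
by rewrite scalerA -mpolyXD addmC.
Qed.

Lemma fm_leT V (M : filtmod V) d x : fm_le M d x -> fm_car M x.
Proof. by rewrite fm_cover; exists d. Qed.

(** This is what makes the induced map on the quotients [Gamma] well defined. *)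
Lemma fm_pred_hom V W (M : filtmod V) (N : filtmod W) (u : V -> W) d x :
  filtered_hom M N u -> fm_pred M d x -> fm_pred N d (u x).
Proof.
move=> [uM uD uZ ule]; have [M0 MD MZ] := fm_submodule M.
have u0 : u 0 = 0 by rewrite -(scale0r 0) uZ // scale0r.
case: d => [->//|d [y [z [hy hz ->]]]]; exists (u y), (fun k => u (z k)).
split; [exact: ule|by move=> k; apply: ule|].
have zM k : fm_car M ('X_k *: z k) by apply: MZ; apply: fm_leT (hz k).
rewrite uD //; [congr (_ + _)|exact: fm_leT hy|]; last first.
  by elim/big_ind: _.
rewrite (eq_bigr (fun k => u ('X_k *: z k))); last first.
  by move=> k _; rewrite uZ //; apply: fm_leT (hz k).
(* Additivity of [u] is available on [fm_car M] only, so membership of the partial sums is carried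
   along the induction. *)
elim/(big_load (fm_car M)): _; elim/big_rec2: _ => // k y1 y2 _ [h1 h2].
by rewrite uD -?h2 //; split; auto.
Qed.

End FilteredModules.

Section TwistedDegree.
Context (F : fieldType) (n : nat).
Local Notation S := {mpoly F[n]}.

(** A coefficientwise degree bound: the zero vector satisfies it for every [d], and sums and
    products are bounded without case distinctions on vanishing entries. *)
Definition wle p (a : 'I_p -> nat) (d : nat) (f : 'cV[S]_p) : Prop :=
  forall i m, (f i 0)@_m != 0 -> (a i + mdeg m <= d)%N.

Lemma wdeg_wle p (a : 'I_p -> nat) d (f : 'cV[S]_p) :
  (wdeg a f <= d)%N <-> wle a d f.
Proof.
rewrite wdeg_leP; split=> h i.
  move=> m; rewrite -mcoeff_msupp => mf.
  have f0 : f i 0 != 0 by apply: contraTneq mf => ->; rewrite msupp0.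
  apply: leq_trans (h i f0); rewrite leq_add2l -ltnS -mpolySpred //.
  exact: msize_mdeg_lt.
move=> f0; rewrite -mlead_deg //=; apply: h.
by rewrite -mcoeff_msupp mlead_supp.
Qed.

Lemma fm_le_freeE p (a : 'I_p -> nat) d (f : 'cV[S]_p) :
  fm_le (fm_free F n a) d f <-> wle a d f.
Proof. exact: wdeg_wle. Qed.

Lemma coldeg_le p r (a : 'I_p -> nat) (G : 'M[S]_(p, r)) i j m :
  (G i j)@_m != 0 -> (a i + mdeg m <= coldeg a G j)%N.
Proof.
by move=> h; have /wdeg_wle := leqnn (coldeg a G j); apply; rewrite mxE.
Qed.

Lemma wle_mulmx p r (a : 'I_p -> nat) (G : 'M[S]_(p, r)) d x :
  wle (coldeg a G) d x -> wle a d (G *m x).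
Proof.
move=> hx i m /mcoeff_mulmx_neq0[j [u [v [-> /coldeg_le gu /hx]]]].
by rewrite mdegD addnA; apply: leq_trans; rewrite leq_add2r gu.
Qed.

(** Equivalently, the unit vectors at positions of twist [d] form a basis of [Gamma] in degree [d]:
    a nonconstant monomial is a multiple of some ['X_k], and a constant at a position of smaller
    twist already has smaller degree. *)
Lemma fm_pred_free p (b : 'I_p -> nat) d (z : 'cV[S]_p) :
  fm_pred (fm_free F n b) d z <->
  wle b d z /\ forall i, b i = d -> (z i 0)@_0%MM = 0.
Proof.
split=> [hz|[hz hz0]].
  split=> [|i bi]; first exact/fm_le_freeE/fm_pred_le.
  case: d hz bi => [->|d [y [w [/fm_le_freeE hy _ ->]]] bi]; first by rewrite mxE mcoeff0.
  rewrite mxE mcoeffD summxE raddf_sum /= big1 => [|k _]; last first.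
    rewrite mxE; apply/eqP/negPn/negP => /mcoeffM_neq0[u [v []]].
    move/esym/eqP; rewrite mnmD_eq0 mcoeffX => /andP[/eqP-> _].
    by rewrite mnm1_eq0 eqxx.
  rewrite addr0; apply/eqP/negPn/negP => /hy.
  by rewrite mdeg0 bi addn0 ltnn.
case: d hz hz0 => [|d] hz hz0.
  apply/matrixP => i j; rewrite ord1 mxE; apply/mpolyP => m; rewrite mcoeff0.
  apply/eqP/negPn/negP => zm; have := hz _ _ zm.
  rewrite leqn0 addn_eq0 mdeg_eq0 => /andP[/eqP bi /eqP m0].
  by move: zm; rewrite m0 hz0 ?eqxx.
have /choice[g hg] : forall i, exists g : 'I_n -> S,
    z i 0 = ((z i 0)@_0%MM)%:MP + \sum_k 'X_k * g k /\
    forall k m, (g k)@_m != 0 -> (z i 0)@_(m + U_(k)) != 0.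
  by move=> i; have [g] := mpolyX_decomp (z i 0); exists g.
(* The constant terms have degree at most [d] because those at twist [d.+1] vanish by hypothesis;
   the cofactors of the ['X_k] do by the support clause. *)
exists (\col_i ((z i 0)@_0%MM)%:MP), (fun k => \col_i g i k); split.
- apply/fm_le_freeE => i m; rewrite mxE mcoeffC.
  have [->|] := eqVneq m 0%MM; last by rewrite mulr0 eqxx.
  rewrite mulr1 mdeg0 addn0 => zi; have := hz _ _ zi.
  rewrite mdeg0 addn0 leq_eqVlt ltnS => /predU1P[bi|//].
  by rewrite hz0 // eqxx in zi.
- move=> k; apply/fm_le_freeE => i m; rewrite mxE => /(hg i).2/hz.
  by rewrite mdegD mdeg1 addn1 addnS.
apply/matrixP => i j; rewrite ord1 [LHS](hg i).1 !mxE summxE; congr (_ + _).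
by apply: eq_bigr => k _; rewrite !mxE.
Qed.

End TwistedDegree.

(** * Minimal systems of generators *)

Section MinimalGenerators.
Context (F : fieldType) (n p r : nat).
Local Notation S := {mpoly F[n]}.
Variables (a : 'I_p -> nat) (K : set 'cV[S]_p) (Ksub : submodule K).
Variable G : 'M[S]_(p, r).
Local Notation b := (coldeg a G).
Local Notation M := (fm_free F n b).
Local Notation N := (fm_induced (fm_free F n a) Ksub).

(* The last clause says that the classes of the columns of degree [d] are
   linearly independent in [Gamma_d(K)]. *)
Definition minimal_gens : Prop :=
  [/\ forall j, K (col j G), forall j, col j G != 0,
      forall d x, K x -> wle a d x -> exists2 c, wle b d c & x = G *m c
    & forall d (c : 'I_r -> F),
        fm_pred N d (G *m \col_j if b j == d then (c j)%:MP else 0) ->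
        forall j, b j = d -> c j = 0].

Hypothesis minG : minimal_gens.

Lemma gens_mulmx x : K (G *m x).
Proof.
have [KG _ _ _] := minG; have [K0 KD KZ] := Ksub.
have -> : G *m x = \sum_j x j 0 *: col j G.
  apply/matrixP => i k; rewrite ord1 mxE summxE; apply: eq_bigr => j _.
  by rewrite !mxE mulrC.
by elim/big_ind: _ => // j _; apply: KZ.
Qed.

Lemma gens_filtered_hom : filtered_hom M N (mulmx G).
Proof.
split=> [x _|x y _ _|c x _|d x /fm_le_freeE hx]; first by split=> //; apply: gens_mulmx.
- exact: mulmxDr.
- by rewrite scalemxAr.
by split; [exact: gens_mulmx|apply/fm_le_freeE/wle_mulmx].
Qed.

(** This is injectivity of the map induced by [G] on [Gamma]. Modulo [fm_pred M d], [z] equals its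
    constants [z0] at positions of degree [d], and these vanish by the independence clause. *)
Lemma gens_fm_pred d z : wle b d z -> fm_pred N d (G *m z) -> fm_pred M d z.
Proof.
have [_ _ _ ind] := minG => hz Gz.
pose c j := (z j 0)@_0%MM; pose z0 : 'cV[S]_r := \col_j if b j == d then (c j)%:MP else 0.
have hz' : fm_pred M d (z - z0).
  apply/fm_pred_free; split=> [i m|i bi].
    rewrite !mxE mcoeffB; case: ifP => _; last first.
      by rewrite mcoeff0 subr0; apply: hz.
    rewrite mcoeffC; have [->|m0] := eqVneq m 0%MM.
      by rewrite mulr1 subrr eqxx.
    by rewrite mulr0 subr0; apply: hz.
  by rewrite !mxE bi eqxx mcoeffB mcoeffC eqxx mulr1 subrr.
have c0 : forall j, b j = d -> c j = 0.
  apply: ind; rewrite -/z0 -(subKr z z0) mulmxBr.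
  by apply: fm_predB => //; apply: fm_pred_hom hz'; apply: gens_filtered_hom.
suff z00 : z0 = 0 by rewrite z00 subr0 in hz'.
by apply/matrixP => i j; rewrite !mxE; case: eqP => // /c0->; rewrite mpolyC0.
Qed.

Lemma Gamma_mapE d x : fm_le M d x ->
  Gamma_map (mulmx G) N d [set x + s | s in fm_pred M d] =
  [set G *m x + s | s in fm_pred N d].
Proof.
move=> hx; apply/seteqP; split=> y.
  move=> [_ [s hs <-] [t ht <-]]; exists (G *m s + t); last by rewrite mulmxDr addrA.
  by apply: fm_predD => //; apply: fm_pred_hom hs; apply: gens_filtered_hom.
move=> [s hs <-]; exists x; last by exists s.
by exists 0; [apply: fm_pred0|rewrite addr0].
Qed.

(** Injectivity on cosets is [gens_fm_pred] applied to a difference of representatives; surjectivity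
    follows from surjectivity in each degree. *)
Lemma minimal_gens_hom : minimal_hom M N (mulmx G).
Proof.
have [_ _ surj _] := minG; split; first exact: gens_filtered_hom.
move=> d; have Gsurj : set_surj (fm_le M d) (fm_le N d) (mulmx G).
  move=> x [Kx /fm_le_freeE hx]; have [c hc ->] := surj d x Kx hx.
  by exists c => //; apply/fm_le_freeE.
split=> //; split.
- move=> _ [x hx <-]; rewrite Gamma_mapE //; exists (G *m x) => //.
  by case: gens_filtered_hom => _ _ _; apply.
- move=> A B /set_mem[x hx <-] /set_mem[y hy <-]; rewrite !Gamma_mapE // => exy.
  have [s hs] : [set G *m y + s | s in fm_pred N d] (G *m x).
    by rewrite -exy; exists 0; [apply: fm_pred0|rewrite addr0].
  move/(canRL (addKr _)) => es; have : fm_pred M d (x - y).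
    apply: gens_fm_pred; first exact/fm_le_freeE/fm_leB.
    by rewrite mulmxBr addrC -es.
  move=> xy; apply/seteqP; split=> _ [t ht <-].
    exists (x - y + t); first exact: fm_predD.
    by rewrite addrA addrCA subrr addr0.
  exists (t - (x - y)); first exact: fm_predB.
  by rewrite opprB addrCA subrKC addrC.
- move=> _ [x hx <-]; have [y hy <-] := Gsurj x hx.
  by exists [set y + s | s in fm_pred M d]; [exists y|apply: Gamma_mapE].
Qed.

End MinimalGenerators.

(** * Leading forms *)

Section LeadingForms.
Context (F : fieldType) (n : nat).
Local Notation S := {mpoly F[n]}.

Definition whomog p (a : 'I_p -> nat) (d : nat) (f : 'cV[S]_p) : Prop :=
  forall i m, (f i 0)@_m != 0 -> (a i + mdeg m)%N = d.

(** The homogeneous component for the grading twisted by [a]. For a vector of degree at most [d] it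
    is the leading form, or zero if the degree is smaller. *)
Definition wpart p (a : 'I_p -> nat) (d : nat) (f : 'cV[S]_p) : 'cV[S]_p :=
  \col_i if (a i <= d)%N then pihomog mdeg (d - a i) (f i 0) else 0.

Lemma mcoeff_wpart p (a : 'I_p -> nat) d (f : 'cV[S]_p) i m :
  (wpart a d f i 0)@_m = if (a i + mdeg m == d)%N then (f i 0)@_m else 0.
Proof.
rewrite mxE; case: leqP => [ad|da].
  by rewrite mcoeff_pihomog -{2}(subnKC ad) eqn_add2l.
by rewrite mcoeff0 ifF //; apply/negbTE; rewrite gtn_eqF // (leq_trans da) ?leq_addr.
Qed.

Lemma mcoeff_lead_mx p r (a : 'I_p -> nat) (b : 'I_r -> nat) (G : 'M[S]_(p, r)) i j m :
  (lead_mx a b G i j)@_m = if (a i + mdeg m == b j)%N then (G i j)@_m else 0.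
Proof.
rewrite mxE; case: leqP => [ad|da].
  by rewrite mcoeff_pihomog -{2}(subnKC ad) eqn_add2l.
by rewrite mcoeff0 ifF //; apply/negbTE; rewrite gtn_eqF // (leq_trans da) ?leq_addr.
Qed.

Lemma wpart_homog p (a : 'I_p -> nat) d (f : 'cV[S]_p) : whomog a d (wpart a d f).
Proof.
by move=> i m; rewrite mcoeff_wpart; case: ifP => [/eqP//|]; rewrite eqxx.
Qed.

Lemma wpart_eq0 p (a : 'I_p -> nat) d (f : 'cV[S]_p) :
  (forall i m, (f i 0)@_m != 0 -> (a i + mdeg m)%N != d) -> wpart a d f = 0.
Proof.
move=> h; apply/matrixP => i j; rewrite ord1 [RHS]mxE; apply/mpolyP => m.
rewrite mcoeff_wpart mcoeff0; case: ifP => // ad.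
by apply/eqP/negPn/negP => /h; rewrite ad.
Qed.

Lemma wpart_id p (a : 'I_p -> nat) d (f : 'cV[S]_p) : whomog a d f -> wpart a d f = f.
Proof.
move=> h; apply/matrixP => i j; rewrite ord1; apply/mpolyP => m.
rewrite mcoeff_wpart; case: ifP => // /negbT ad.
by apply/esym/eqP/negPn/negP => /h/eqP; rewrite (negPf ad).
Qed.

Lemma wpartD p (a : 'I_p -> nat) d (f g : 'cV[S]_p) :
  wpart a d (f + g) = wpart a d f + wpart a d g.
Proof.
apply/matrixP => i j; rewrite ord1 [RHS]mxE; apply/mpolyP => m.
by rewrite mcoeffD !mcoeff_wpart mxE mcoeffD; case: ifP; rewrite ?addr0.
Qed.

Lemma wpart_sum p (a : 'I_p -> nat) N (f : 'cV[S]_p) :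
  wle a N f -> f = \sum_(d < N.+1) wpart a d f.
Proof.
move=> hf; apply/matrixP => i j; rewrite ord1 summxE; apply/mpolyP => m.
rewrite raddf_sum /=; under eq_bigr do rewrite mcoeff_wpart.
have [->|fm] := eqVneq ((f i 0)@_m) 0.
  by rewrite big1 // => d _; case: ifP.
have ltN : (a i + mdeg m < N.+1)%N by rewrite ltnS hf.
rewrite (bigD1 (Ordinal ltN)) //= eqxx big1 ?addr0 // => d dN.
by rewrite ifF //; apply: contraNF dN => /eqP ad; apply/eqP/val_inj.
Qed.

Lemma whomog_delta p (a : 'I_p -> nat) j :
  whomog a (a j) (delta_mx j 0 : 'cV[S]_p).
Proof.
move=> i m; rewrite mxE eqxx andbT; have [->|_] := eqVneq i j; last by rewrite mcoeff0 eqxx.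
by rewrite mcoeff1; have [->|_] := eqVneq m 0%MM; rewrite ?eqxx // mdeg0 addn0.
Qed.

Section Lead.
Variables (p r : nat) (a : 'I_p -> nat) (G : 'M[S]_(p, r)).
Local Notation b := (coldeg a G).
Local Notation L := (lead_mx a b G).

Lemma whomog_lead d x : whomog b d x -> whomog a d (L *m x).
Proof.
move=> hx i m /mcoeff_mulmx_neq0[j [u [v [-> ]]]].
rewrite mcoeff_lead_mx; case: ifP => [/eqP ab|]; last by rewrite eqxx.
by move=> _ /hx <-; rewrite mdegD addnA ab.
Qed.

(** The leading matrix is homogeneous of degree zero between the twisted gradings, so it commutes
    with taking components. *)
Lemma wpart_lead d x : wpart a d (L *m x) = L *m wpart b d x.
Proof.
have [N hN] : exists N, wle b N x by exists (wdeg b x); apply/wdeg_wle.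
rewrite [in LHS](wpart_sum hN) mulmx_sumr.
have -> : wpart a d (\sum_(e < N.+1) L *m wpart b e x) =
    \sum_(e < N.+1) if e == d :> nat then L *m wpart b e x else 0.
  elim/big_rec2: _ => [|e y1 y2 _ <-].
    by rewrite wpart_eq0 // => i m; rewrite mxE mcoeff0 eqxx.
  rewrite wpartD; congr (_ + _); case: eqP => [<-|/eqP ed].
    by apply: wpart_id; apply: whomog_lead; apply: wpart_homog.
  by apply: wpart_eq0 => i m /(whomog_lead (@wpart_homog _ b e x))->.
rewrite -big_mkcond /=; have [dN|Nd] := ltnP d N.+1.
  by rewrite (big_pred1 (Ordinal dN)).
rewrite big_pred0 => [|e]; last by rewrite ltn_eqF // (leq_trans (ltn_ord e)).
rewrite wpart_eq0 ?mulmx0 // => i m /hN => le; apply: contraTneq Nd => <-.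
by rewrite -ltnNge ltnS.
Qed.

(** The terms of [G - L] have degree strictly below the column degree, so on vectors of degree at
    most [d] they contribute nothing in degree [d]. *)
Lemma wpart_mulmx d x : wle b d x -> wpart a d (G *m x) = L *m wpart b d x.
Proof.
move=> hx; rewrite -wpart_lead.
have -> : G *m x = (G - L) *m x + L *m x by rewrite -mulmxDl subrK.
rewrite wpartD.
rewrite (_ : wpart a d ((G - L) *m x) = 0) ?add0r //.
apply: wpart_eq0 => i m /mcoeff_mulmx_neq0[j [u [v [-> ]]]].
rewrite mxE mxE mcoeffB mcoeff_lead_mx.
case: ifP => [_|/negbT ab]; first by rewrite subrr eqxx.
rewrite subr0 => /coldeg_le gu /hx xv; rewrite mdegD addnA ltn_eqF //.
by apply: leq_trans xv; rewrite -addSn leq_add2r ltn_neqAle ab gu.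
Qed.

End Lead.

Lemma wle_wpart0 p (a : 'I_p -> nat) d (f : 'cV[S]_p) :
  wle a d.+1 f -> wpart a d.+1 f = 0 -> wle a d f.
Proof.
move=> hf f0 i m fm; have := hf i m fm; rewrite leq_eqVlt => /predU1P[ad|//].
move/matrixP/(_ i 0)/mpolyP/(_ m): f0.
by rewrite mcoeff_wpart ad eqxx mxE mcoeff0 => f0; rewrite f0 eqxx in fm.
Qed.

Lemma wle0_wpart0 p (a : 'I_p -> nat) (f : 'cV[S]_p) :
  wle a 0 f -> wpart a 0 f = 0 -> f = 0.
Proof.
move=> hf f0; rewrite -f0 wpart_id // => i m /hf.
by rewrite leqn0 => /eqP.
Qed.

(* Exactness of the leading forms is strictness of the maps: a leading syzygy of
   [G] of degree [d] lifts to a syzygy of the same degree. *)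
Lemma lead_exact p r s (a : 'I_p -> nat) (K : set 'cV[S]_p) (Ksub : submodule K)
    (G : 'M[S]_(p, r)) (H : 'M[S]_(r, s)) :
  let b := coldeg a G in
  minimal_gens a Ksub G -> minimal_gens b (submodule_ker G) H ->
  ker_mx (lead_mx a b G) = im_mx (lead_mx b (coldeg b H) H).
Proof.
move=> b minG minH; have [KG _ Gsurj _] := minG; have [KH _ Hsurj _] := minH.
have lift d x : whomog b d x -> lead_mx a b G *m x = 0 ->
    exists z, x = lead_mx b (coldeg b H) H *m z.
  move=> hx Lx; have xd : wle b d x by move=> i m /hx->.
  have Gx : wpart a d (G *m x) = 0 by rewrite wpart_mulmx // wpart_id.
  have Gxd : wle a d (G *m x) by apply: wle_mulmx.
  (* The leading form of [G *m x] vanishes, so its degree is smaller than [d], and generation in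
     that degree gives a preimage [y] of smaller degree. For [d = 0] the image is zero and
     [y = 0]. *)
  have [y [yd hy Gy]] : exists y, [/\ wle b d y, wpart b d y = 0 & G *m x = G *m y].
    case: d hx xd Gx Gxd => [|d] hx xd Gx Gxd.
      exists 0; rewrite mulmx0 (wle0_wpart0 Gxd) //.
      by split=> //; [move=> i m|apply: wpart_eq0 => i m]; rewrite mxE mcoeff0 eqxx.
    have [c hc Gc] := Gsurj d _ (gens_mulmx minG x) (wle_wpart0 Gxd Gx).
    exists c; split=> //; first by move=> i m /hc/leqW.
    by apply: wpart_eq0 => i m /hc h; rewrite ltn_eqF.
  (* Now [x - y] is a true syzygy with leading form [x], and [H] reaches it without raising the
     degree. *)
  have [||z zd hz] := Hsurj d (x - y).
  - by rewrite /ker_mx /= mulmxBr Gy subrr.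
  - move=> i m; rewrite !mxE mcoeffB => xy.
    have [x0|] := eqVneq ((x i 0)@_m) 0; last exact: xd.
    by apply: (yd i m); move: xy; rewrite x0 sub0r oppr_eq0.
  exists (wpart (coldeg b H) d z); rewrite -wpart_mulmx // -hz.
  by rewrite -[LHS](wpart_id hx) -[in LHS](subrK y x) [LHS]wpartD hy addr0.
apply/seteqP; split=> x.
  rewrite /ker_mx /= => Lx; have [N hN] : exists N, wle b N x.
    by exists (wdeg b x); apply/wdeg_wle.
  have /choice[z hz] : forall d : nat, exists z : 'cV[S]_s,
      wpart b d x = lead_mx b (coldeg b H) H *m z.
    move=> d; apply: (lift d); first exact: wpart_homog.
    rewrite -wpart_lead Lx wpart_eq0 // => i m; by rewrite mxE mcoeff0 eqxx.
  exists (\sum_(d < N.+1) z d) => //; rewrite mulmx_sumr [RHS](wpart_sum hN).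
  by apply: eq_bigr => d _; rewrite hz.
move=> [z _ <-]; rewrite /ker_mx /= mulmxA.
(* Column by column, the product is a homogeneous component of [G *m col j H], which is zero. *)
suff -> : lead_mx a b G *m lead_mx b (coldeg b H) H = 0 by rewrite mul0mx.
apply/matrixP => i j; rewrite [RHS]mxE.
have hj : lead_mx b (coldeg b H) H *m delta_mx j 0 = wpart b (coldeg b H j) (col j H).
  rewrite colE wpart_mulmx; last by move=> k m /whomog_delta->.
  by rewrite wpart_id //; apply: whomog_delta.
transitivity ((lead_mx a b G *m (lead_mx b (coldeg b H) H *m (delta_mx j 0 : 'cV[S]_s))) i 0).
  by rewrite mulmxA -colE [RHS]mxE.
rewrite hj -wpart_mulmx; last by apply/wdeg_wle.
by rewrite KH wpart_eq0 => [|k m]; rewrite mxE ?mcoeff0 ?eqxx.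
Qed.

End LeadingForms.

(** * Termination *)

Section Termination.
Context (F : fieldType) (n : nat).
Local Notation S := {mpoly F[n]}.

(** A column of [H] is killed by [G], so by [gens_fm_pred] it lies in [fm_pred] of the free module.
    By [fm_pred_free] it has no constant at a position of full degree, the only place where the
    leading matrix could keep one. *)
Lemma lead_mcoeff0 p r s (a : 'I_p -> nat) (K : set 'cV[S]_p) (Ksub : submodule K)
    (G : 'M[S]_(p, r)) (H : 'M[S]_(r, s)) i j :
  let b := coldeg a G in
  minimal_gens a Ksub G -> minimal_gens b (submodule_ker G) H ->
  (lead_mx b (coldeg b H) H i j)@_0%MM = 0.
Proof.
move=> b minG [KH _ _ _]; rewrite mcoeff_lead_mx mdeg0 addn0.
case: eqP => // bi; have : fm_pred (fm_free F n b) (coldeg b H j) (col j H).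
  apply: (gens_fm_pred minG); first exact/wdeg_wle.
  by rewrite KH; apply: fm_pred0.
by move/fm_pred_free => [_ /(_ i bi)]; rewrite mxE.
Qed.

Lemma mulmx_im_ker p r s (A : 'M[S]_(p, r)) (B : 'M[S]_(r, s)) :
  im_mx B `<=` ker_mx A -> A *m B = 0.
Proof.
move=> BA; apply/matrixP => i j; have : col j (A *m B) = 0.
  by rewrite colE -mulmxA; apply: BA; eexists.
by move/matrixP/(_ i 0); rewrite mxE => ->; rewrite !mxE.
Qed.

Variables (p : nat -> nat) (A : forall k, 'M[S]_(p k, p k.+1)).
Arguments A : clear implicits.
Hypothesis exactA : forall k, ker_mx (A k) = im_mx (A k.+1).

(* Killing one more indeterminate costs one step of exactness, because the
   indeterminate is a nonzerodivisor on the previous quotients. *)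
Lemma exact_subst0 l : (l <= n)%N -> forall k (v : 'cV[S]_(p k.+1)), (l <= k)%N ->
  map_mx (subst0 l) (A k *m v) = 0 ->
  exists t, map_mx (subst0 l) (v - A k.+1 *m t) = 0.
Proof.
elim: l => [_ k v _ Av|l IH ln [//|k] v lk Av].
  have e0 q s (B : 'M[S]_(q, s)) : map_mx (subst0 0) B = B.
    by apply/matrixP => i j; rewrite mxE subst0_0.
  rewrite e0 in Av; have : ker_mx (A k) v by [].
  by rewrite exactA => -[t _ <-]; exists t; rewrite e0 subrr.
pose x := Ordinal ln; pose X : S := 'X_x.
have X0 : X != 0 by rewrite -msize_poly_eq0 msizeX.
have Xl : subst0 l X = X.
  rewrite /X subst0X ifT //; apply/forallP => i; apply/implyP => il.
  by rewrite mnm1E; have [e|//] := eqVneq x i; rewrite -e ltnn in il.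
(* Modulo the first [l.+1] indeterminates the image of [v] vanishes, so modulo the first [l] it is
   [X] times a vector [wv]. *)
have /choice[w hw] : forall i, exists g, subst0 l ((A k.+1 *m v) i 0) = subst0 l (X * g).
  move=> i; have [g hg _] := subst0_S x ((A k.+1 *m v) i 0); exists g.
  have Avi : subst0 l.+1 ((A k.+1 *m v) i 0) = 0.
    by move/matrixP/(_ i 0): Av; rewrite mxE [RHS]mxE.
  by have := congr1 (subst0 l) hg; rewrite Avi addr0 (subst0_idem _ (leqnn l)).
have AA : A k *m A k.+1 = 0 by apply: mulmx_im_ker; rewrite exactA.
pose wv := \col_i w i.
have hwv : map_mx (subst0 l) (A k.+1 *m v) = X *: map_mx (subst0 l) wv.
  by apply/matrixP => i j; rewrite ord1 [LHS]mxE hw rmorphM /= Xl !mxE.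
(* Cancelling [X] shows that [wv] is a syzygy of [A k] modulo the first [l] indeterminates. This use
   of the hypothesis one place earlier is the loss of one step. *)
have [||u hu] := IH (ltnW ln) k wv.
- exact: lk.
- have /matrixP h : X *: map_mx (subst0 l) (A k *m wv) = 0.
    rewrite map_mxM scalemxAr -hwv -map_mxM mulmxA.
    by rewrite AA mul0mx map_mx0.
  apply/matrixP => i j; have := h i j; rewrite mxE [RHS]mxE => /eqP.
  by rewrite mulf_eq0 (negPf X0) /= => /eqP->; rewrite mxE.
(* Correcting [v] by [X *: u] makes it a syzygy modulo the first [l] indeterminates; the correction
   disappears when [X] is set to zero. *)
have [||t ht] := IH (ltnW ln) k.+1 (v - X *: u).
- exact: ltnW.
- rewrite mulmxBr -scalemxAr map_mxB hwv map_mxZ /= Xl -scalerBr -map_mxB hu.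
  by rewrite scaler0.
have XS : subst0 l.+1 X = 0.
  by rewrite /X subst0X ifF //; apply/negP => /forallP/(_ x); rewrite ltnSn mnm1E eqxx.
have {ht} : map_mx (subst0 l.+1) (v - X *: u - A k.+2 *m t) = 0.
  apply/matrixP => i j; rewrite mxE -(subst0_idem _ (leqnSn l)).
  by move/matrixP/(_ i j): ht; rewrite mxE => ->; rewrite !mxE rmorph0.
by rewrite addrAC map_mxB map_mxZ /= XS scale0r subr0; exists t.
Qed.

(** With all indeterminates killed, [A n] and [A n.+1] become zero, yet exactness at their common
    module survives, so that module has rank zero. Positivity of [n] puts [A n] among the matrices
    without constant terms. *)
Lemma minimal_exact_stop :
  (0 < n)%N -> (forall k i j, (0 < k)%N -> (A k i j)@_0%MM = 0) -> p n.+1 = 0%N.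
Proof.
move=> n0 A0; apply/eqP; rewrite -leqn0 leqNgt; apply/negP => p0.
have cst k q (v : 'M[S]_(_, q)) : (0 < k)%N -> map_mx (subst0 n) (A k *m v) = 0.
  move=> k0; rewrite map_mxM (_ : map_mx _ (A k) = 0) ?mul0mx //.
  by apply/matrixP => i j; rewrite !mxE /= subst0_n A0 // mpolyC0.
pose v : 'cV[S]_(p n.+1) := const_mx 1.
have [t] := @exact_subst0 n (leqnn n) n v (leqnn n) (cst _ _ _ n0).
rewrite map_mxB cst // subr0 => /matrixP/(_ (Ordinal p0) 0).
by rewrite !mxE /= (rmorph1 (subst0 n)) => /eqP; rewrite oner_eq0.
Qed.

End Termination.

(** * Existence of minimal generators *)

Section Dickson.

(** After each position choose one where [h] takes its least value from there on; iterating this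
    choice gives the subsequence. *)
Lemma nondecreasing_subseq (h : nat -> nat) : exists phi : nat -> nat,
  {homo phi : s t / (s < t)%N} /\ {homo h \o phi : s t / (s <= t)%N}.
Proof.
have /choice[arg harg] : forall N, exists k, (N <= k)%N /\
    forall l, (N <= l)%N -> (h k <= h l)%N.
  move=> N; have ex : exists y, `[< exists2 k, (N <= k)%N & h k = y >].
    by exists (h N); apply/asboolP; exists N.
  case: (ex_minnP ex) => y /asboolP[k Nk <-] kmin; exists k; split=> // l Nl.
  by apply: kmin; apply/asboolP; exists l.
pose phi s := iter s (fun k => arg k.+1) (arg 0%N).
have phiS s : (phi s < phi s.+1)%N by exact: (harg _).1.
exists phi; split; first exact: homo_ltn ltn_trans phiS.
apply: homo_leq => [//||s]; first exact: leq_trans.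
case: s => [|s]; first exact: (harg 0%N).2.
by apply: (harg (phi s).+1).2; apply: leq_trans (phiS s) (ltnW (phiS _)).
Qed.

Lemma nondecreasing_subseqs (I : eqType) (c : I -> nat -> nat) (s : seq I) :
  exists phi : nat -> nat, {homo phi : u v / (u < v)%N} /\
    forall i, i \in s -> {homo c i \o phi : u v / (u <= v)%N}.
Proof.
elim: s => [|i s [phi [phiM IH]]]; first by exists id; split=> // i; rewrite in_nil.
have [psi [psiM hpsi]] := nondecreasing_subseq (c i \o phi).
exists (phi \o psi); split=> [u v uv|j]; first exact/phiM/psiM.
rewrite inE => /predU1P[->|/IH hj] u v uv; first exact: hpsi.
by apply: hj; apply: (ltnW_homo psiM).
Qed.

Lemma dickson p n (g : nat -> 'I_p * 'X_{1..n}) :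
  exists s t, [/\ (s < t)%N, (g s).1 = (g t).1 & ((g s).2 <= (g t).2)%MM].
Proof.
(* The position is recorded both as itself and as its complement in [p]: if both do not decrease,
   the two positions are equal. *)
pose c (i : bool + 'I_n) (s : nat) : nat := match i with
  | inl true => (g s).1 | inl false => (p - (g s).1)%N | inr k => (g s).2 k end.
have [phi [phiM hphi]] := nondecreasing_subseqs c (enum {: bool + 'I_n}).
have {}hphi i : (c i (phi 0) <= c i (phi 1))%N.
  have ci : i \in enum {: bool + 'I_n} by rewrite mem_enum.
  exact: (hphi i ci 0%N 1%N).
exists (phi 0%N), (phi 1%N); split; first exact: phiM.
  apply/val_inj/eqP; rewrite eqn_leq (hphi (inl true)) /=.
  have /= := hphi (inl false); by rewrite leq_sub2lE // ltnW.
by apply/mnm_lepP => k; apply: (hphi (inr k)).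
Qed.

End Dickson.

(** * Leading terms and the generators they single out *)

Section LeadingTerms.
Import Order.DefaultProdLexiOrder.
Context (F : fieldType) (n : nat).
Local Notation S := {mpoly F[n]}.
Local Notation term p := ('I_p * 'X_{1..n})%type.

Definition tdeg p (a : 'I_p -> nat) (t : term p) : nat := (a t.1 + mdeg t.2)%N.

(** Only terms of twisted degree exactly [d] compete, so this is the leading term of the component
    [wpart a d f]. The order compares positions first, then monomials. *)
Definition lead_term p (a : 'I_p -> nat) (d : nat) (f : 'cV[S]_p) (t : term p) :=
  [/\ tdeg a t = d, (f t.1 0)@_t.2 != 0 &
      forall u : term p, tdeg a u = d -> (f u.1 0)@_u.2 != 0 -> (u <= t)%O].

Lemma term_wf p : well_founded (fun t u : term p => (t < u)%O).
Proof.
suff wf N (i : 'I_p) (m : 'X_{1..n}) : (i < N)%N -> Acc (fun t u : term p => (t < u)%O) (i, m).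
  by move=> [i m]; apply: (wf p).
elim: N i m => [i m|N IH i m iN]; first by rewrite ltn0.
elim/(@ltmwf n): m => m IHm.
constructor=> -[j u].
rewrite ltEprodlexi /= => /andP[ji].
have [<-|ij] := eqVneq i j; first by rewrite lexx /=; apply: IHm.
move=> _; apply: IH; apply: (@leq_trans i); last by rewrite -ltnS.
by rewrite ltn_neqAle eq_sym ij.
Qed.

Lemma lead_term_exists p (a : 'I_p -> nat) d (f : 'cV[S]_p) :
  wpart a d f = 0 \/ exists t, lead_term a d f t.
Proof.
have [f0|[i [m [im fim]]]] : (forall i m, (f i 0)@_m != 0 -> (a i + mdeg m)%N != d) \/
    exists i m, tdeg a (i, m) = d /\ (f i 0)@_m != 0.
  apply: contrapT => /not_orP[h1 h2]; apply: h1 => i m fim.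
  by apply/eqP => im; apply: h2; exists i, m.
  by left; apply: wpart_eq0.
(* A term of twisted degree [d] has a monomial of degree at most [d], so the maximum is taken over a
   finite type. *)
right; pose Q (t : 'I_p * 'X_{1..n < d.+1}) :=
  (tdeg a (t.1, val t.2) == d) && ((f t.1 0)@_(val t.2) != 0).
have bnd (t : term p) : tdeg a t = d -> (mdeg t.2 < d.+1)%N.
  by rewrite /tdeg => <-; rewrite ltnS leq_addl.
have Qim : Q (i, BMultinom (bnd (i, m) im)) by rewrite /Q /= im eqxx fim.
case: (arg_maxP (fun t => (t.1, val t.2) : term p) Qim) => t /andP[/eqP td ft] tmax.
exists (t.1, val t.2); split=> // u ud fu.
by apply: (tmax (u.1, BMultinom (bnd u ud))); rewrite /Q /= -surjective_pairing ud eqxx.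
Qed.

Lemma lead_term_mulX p (a : 'I_p -> nat) d (f : 'cV[S]_p) t u :
  lead_term a d f t ->
  lead_term a (d + mdeg u) ('X_[u] *: f) (t.1, t.2 + u)%MM.
Proof.
move=> [td ft tmax]; split=> [||v].
- by rewrite /tdeg /= mdegD addnA -td.
- by rewrite /= mxE mulrC addmC mcoeffMX.
rewrite mxE => vd /mcoeffM_neq0[w [m [vE]]].
rewrite mcoeffX; have [uw _ fm|] := eqVneq u w; last by rewrite eqxx.
rewrite -uw {w uw} in vE.
have /tmax/(_ fm) : tdeg a (v.1, m) = d.
  by apply/eqP; rewrite -(eqn_add2r (mdeg u)) -vd /tdeg /= vE mdegD addnAC addnA.
by rewrite !leEprodlexi /= vE addmC lemc_add2l.
Qed.

Section Generators.
Variables (p : nat) (a : 'I_p -> nat) (K : set 'cV[S]_p) (Ksub : submodule K).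
Local Notation N := (fm_induced (fm_free F n a) Ksub).

Lemma fm_le_inducedE d x : fm_le N d x <-> K x /\ wle a d x.
Proof. by split=> -[Kx /fm_le_freeE hx]; split. Qed.

Lemma wpart0_pred d x : fm_le N d x -> wpart a d x = 0 -> fm_pred N d x.
Proof.
move=> /fm_le_inducedE[Kx]; case: d => [|d] hx x0; first exact: wle0_wpart0 hx x0.
by apply: (@fm_pred_lt _ _ _ _ _ d) => //; apply/fm_le_inducedE; split=> //; apply: wle_wpart0.
Qed.

(* Elements of [K] are reduced by subtracting elements of [W] with the same
   leading term. *)
Lemma lead_term_cover d (W : set 'cV[S]_p) :
  (forall x y, W x -> W y -> W (x + y)) ->
  (forall (c : F) x, W x -> W (c%:MP *: x)) ->
  W `<=` fm_le N d -> fm_pred N d `<=` W ->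
  (forall f t, fm_le N d f -> lead_term a d f t -> exists2 g, W g & lead_term a d g t) ->
  fm_le N d `<=` W.
Proof.
move=> WD WZ WN NW Wlead.
suff main t f : fm_le N d f -> lead_term a d f t -> W f.
  move=> f hf; have [f0|[t]] := lead_term_exists a d f; last exact: main.
  exact/NW/wpart0_pred.
elim: t / (@term_wf p t) f => t _ IH f hf ft.
have [g Wg gt] := Wlead f t hf ft.
(* This scalar cancels the leading coefficients; what remains has no leading term in degree [d] or a
   strictly smaller one. *)
pose c := (f t.1 0)@_t.2 / (g t.1 0)@_t.2.
rewrite -(subrK (c%:MP *: g) f); apply: (WD); last exact: WZ.
have hh : fm_le N d (f - c%:MP *: g) by apply: fm_leB => //; apply/WN/WZ.
have [f0|[u hu]] := lead_term_exists a d (f - c%:MP *: g).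
  exact/NW/wpart0_pred.
apply: (IH u) => //; have [ud + _] := hu; rewrite lt_neqAle.
have [_ gt0 gmax] := gt; have [_ ft0 fmax] := ft.
rewrite !mxE mcoeffB mcoeffCM; have [->|_ /=] := eqVneq u t.
  by rewrite divfK // subrr eqxx.
have [fu|fu _] := eqVneq ((f u.1 0)@_u.2) 0; last exact: fmax.
rewrite fu sub0r oppr_eq0 mulf_eq0 negb_or => /andP[_]; exact: gmax.
Qed.

Definition new_lead : set (term p) := [set t |
  (exists2 f, fm_le N (tdeg a t) f & lead_term a (tdeg a t) f t) /\
  ~ exists2 g, fm_pred N (tdeg a t) g & lead_term a (tdeg a t) g t].

(** In an infinite family, Dickson gives two distinct terms, one a proper monomial multiple of the
    other. Multiplying an element that realises the smaller one puts the larger into the leading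
    terms of [fm_pred], so it is not new. *)
Lemma new_lead_finite : finite_set new_lead.
Proof.
apply: contrapT => inf.
have [g [ginj hg]] : exists g : nat -> term p, injective g /\ forall s, new_lead (g s).
  have [t0 _] := infinite_setN0 inf.
  pose T : pointedType := HB.pack (term p) (isPointed.Build (term p) t0).
  move/infiniteP/(@pcard_leP _ T): inf => -[f]; exists f; split.
    by move=> s t; apply: inj; rewrite in_setT.
  by move=> s; apply: funS.
have [s [t [st e1 le2]]] := dickson g.
have [[f hf ft] _] := hg s; have [_] := hg t; apply.
pose u := ((g t).2 - (g s).2)%MM.
have eu : g t = ((g s).1, (g s).2 + u)%MM.
  by rewrite e1 addmC submK // -surjective_pairing.
have ed : tdeg a (g t) = (tdeg a (g s) + mdeg u)%N.
  by rewrite eu /tdeg /= mdegD addnA.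
exists ('X_[u] *: f); rewrite ed; last by rewrite eu; apply: lead_term_mulX.
apply: fm_pred_Xm => //; apply/eqP => u0; move: eu; rewrite u0 addm0 -surjective_pairing.
by move/ginj => ts; rewrite ts ltnn in st.
Qed.

End Generators.

(** One column is taken for each new leading term. Generation follows from [lead_term_cover] and
    induction on the degree, independence from the leading terms being distinct and new. *)
Lemma minimal_gens_exist p (a : 'I_p -> nat) (K : set 'cV[S]_p) (Ksub : submodule K) :
  exists r (G : 'M[S]_(p, r)), minimal_gens a Ksub G.
Proof.
set N := fm_induced (fm_free F n a) Ksub.
have /finite_seqP[s0 es0] := new_lead_finite a Ksub.
pose s := undup s0; pose r := size s.
have memT t : new_lead a Ksub t <-> t \in s by rewrite mem_undup es0.
have /choice[fam hfam] : forall t, exists f : 'cV[S]_p, new_lead a Ksub t ->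
    fm_le N (tdeg a t) f /\ lead_term a (tdeg a t) f t.
  move=> t; have [[[f hf ft] _]|nt] := pselect (new_lead a Ksub t); last by exists 0.
  by exists f.
pose t_ (j : 'I_r) := tnth (in_tuple s) j.
have t_inj : injective t_ by apply/tuple_uniqP; rewrite undup_uniq.
have newt j : new_lead a Ksub (t_ j) by apply/memT/mem_tnth.
pose G := \matrix_(i, j) fam (t_ j) i 0.
have colG j : col j G = fam (t_ j).
  by apply/matrixP => i k; rewrite ord1 !mxE.
have fam_lead j : lead_term a (tdeg a (t_ j)) (fam (t_ j)) (t_ j).
  by case: (hfam (t_ j) (newt j)).
have fam_le j : fm_le N (tdeg a (t_ j)) (fam (t_ j)).
  by case: (hfam (t_ j) (newt j)).
have degG j : coldeg a G j = tdeg a (t_ j).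
  apply/eqP; rewrite eqn_leq; apply/andP; split.
    by rewrite /coldeg colG; case: (fam_le j).
  by apply: coldeg_le; rewrite mxE; case: (fam_lead j).
pose comb d (c : 'I_r -> F) : 'cV[S]_r :=
  \col_j if coldeg a G j == d then (c j)%:MP else 0.
have combE d c : G *m comb d c =
    \sum_(j | coldeg a G j == d) (c j)%:MP *: fam (t_ j).
  apply/matrixP => i k; rewrite ord1 mxE summxE [RHS]big_mkcond.
  apply: eq_bigr => j _; rewrite !mxE; case: ifP => _; last by rewrite mulr0.
  by rewrite mulrC.
have comb_le d c : wle (coldeg a G) d (comb d c).
  move=> j m; rewrite mxE; case: ifP => [/eqP <-|]; last by rewrite mcoeff0 eqxx.
  by rewrite mcoeffC; have [->|] := eqVneq m 0%MM; rewrite ?mulr0 ?eqxx // mdeg0 addn0.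
have comb_fm_le d c : fm_le N d (G *m comb d c).
  by rewrite combE; apply: fm_le_sum => j /eqP <-; apply: fm_leZ; rewrite degG.
exists r, G; split.
- by move=> j; rewrite colG; case: (fam_le j).
- move=> j; rewrite colG; have [_ ft _] := fam_lead j.
  by apply: contraNneq ft => ->; rewrite mxE mcoeff0.
(* In degree [d], every leading term is either realised in [fm_pred N d] or new, and then it is the
   leading term of a column. *)
- have cover d x : fm_le N d x -> exists c y, fm_pred N d y /\ x = G *m comb d c + y.
    apply: (lead_term_cover (K := K) (W := fun x => exists c y,
      fm_pred N d y /\ x = G *m comb d c + y)).
    + move=> _ _ [c [y [hy ->]]] [c' [y' [hy' ->]]].
      exists (fun j => c j + c' j), (y + y'); split; first exact: fm_predD.
      rewrite addrACA; congr (_ + _); rewrite !combE -big_split.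
      by apply: eq_bigr => j _; rewrite mpolyCD scalerDl.
    + move=> e _ [c [y [hy ->]]]; exists (fun j => e * c j), (e%:MP *: y).
      split; first exact: fm_predZ.
      rewrite scalerDr !combE scaler_sumr; congr (_ + _).
      by apply: eq_bigr => j _; rewrite mpolyCM scalerA.
    + by move=> _ [c [y [hy ->]]]; apply: fm_leD => //; apply: fm_pred_le.
    + move=> y hy; exists (fun=> 0), y; split=> //.
      by rewrite combE big1 ?add0r // => j _; rewrite mpolyC0 scale0r.
    move=> f t hf ft; have [td _ _] := ft.
    have [/memT/seq_tnthP|] := pselect (new_lead a Ksub t); last first.
      move=> nt; have [g hg gt] : exists2 g, fm_pred N d g & lead_term a d g t.
        by apply: contrapT => ng; apply: nt; split; rewrite td => //; exists f.
      exists g => //; exists (fun=> 0), g; split=> //.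
      by rewrite combE big1 ?add0r // => j _; rewrite mpolyC0 scale0r.
    move=> [j tj]; exists (fam t); last by rewrite -td tj; apply: fam_lead.
    exists (fun k => (k == j)%:R), 0; split; first exact: fm_pred0.
    rewrite addr0 combE (bigD1 j) /=; last by rewrite degG -td tj.
    rewrite eqxx mpolyC1 scale1r big1 ?addr0 ?tj // => k /andP[_ /negPf->].
    by rewrite mpolyC0 scale0r.
  suff main d x : fm_le N d x -> exists2 c, wle (coldeg a G) d c & x = G *m c.
    by move=> d x Kx hx; apply: main; apply/fm_le_inducedE.
  elim/ltn_ind: d x => d IH x /cover[c [y [hy ->]]].
  suff [z hz ->] : exists2 z, wle (coldeg a G) d z & y = G *m z.
    exists (comb d c + z); last by rewrite mulmxDr.
    by apply/fm_le_freeE; apply: fm_leD; apply/fm_le_freeE.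
  case: d IH hy {c} => [_ ->|d IH [u [v [hu hv ->]]]].
    by exists 0; rewrite ?mulmx0 // => i m; rewrite mxE mcoeff0 eqxx.
  have [cu hcu ->] := IH d (ltnSn d) u hu.
  have /choice[cv hcv] : forall k, exists w, wle (coldeg a G) d w /\ v k = G *m w.
    by move=> k; have [w] := IH d (ltnSn d) _ (hv k); exists w.
  exists (cu + \sum_k 'X_k *: cv k).
    apply/fm_le_freeE; apply: fm_leD; first exact/fm_leS/fm_le_freeE.
    by apply: fm_le_sum => k _; apply: fm_leX; apply/fm_le_freeE; case: (hcv k).
  rewrite mulmxDr mulmx_sumr; congr (_ + _); apply: eq_bigr => k _.
  by rewrite -scalemxAr (hcv k).2.
move=> d c; rewrite -/(comb d c) => hc j0 bj0; apply: contrapT => /eqP cj0.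
pose P j := (coldeg a G j == d) && (c j != 0).
have Pj0 : P j0 by rewrite /P bj0 eqxx.
(* The largest leading term with nonzero coefficient cannot cancel, so it is the leading term of the
   combination. As that lies in [fm_pred N d], the term would not be new. *)
case: (arg_maxP t_ Pj0) => j /andP[/eqP bj cj] jmax.
have [_ notnew] := newt j; apply: notnew; rewrite -degG bj.
exists (G *m comb d c) => //; split; first by rewrite -degG.
- rewrite combE summxE raddf_sum /= (bigD1 j) /=; last exact/eqP.
  rewrite big1 ?addr0 => [|k /andP[/eqP bk kj]].
    by rewrite mxE mcoeffCM mulf_neq0 //; case: (fam_lead j).
  rewrite mxE mcoeffCM; apply/eqP; rewrite mulf_eq0 -[_ || _]negbK negb_or.
  apply/negP => /andP[ck fk]; case/negP: kj; apply/eqP/t_inj/le_anti/andP.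
  split; first by apply: jmax; rewrite /P bk eqxx.
  by have [_ _] := fam_lead k; apply=> //; rewrite -!degG bk.
- move=> u ud; rewrite combE summxE => /mcoeff_sum_neq0[k /eqP bk].
  rewrite mxE mcoeffCM mulf_eq0 negb_or => /andP[ck fk].
  apply: (@le_trans _ _ (t_ k)); last by apply: jmax; rewrite /P bk eqxx.
  by have [_ _] := fam_lead k; apply=> //; rewrite -degG bk.
Qed.

End LeadingTerms.

(** * The resolution *)

Section Resolution.
Context (F : fieldType) (n : nat).
Local Notation S := {mpoly F[n]}.

Lemma minimal_gens_im p r (a : 'I_p -> nat) (K : set 'cV[S]_p) (Ksub : submodule K)
  (G : 'M[S]_(p, r)) : minimal_gens a Ksub G -> im_mx G = K.
Proof.
move=> minG; apply/seteqP; split=> [_ [x _ <-]|x Kx]; first exact: gens_mulmx minG x.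
have [_ _ surj _] := minG.
have [c _ ->] := surj (wdeg a x) x Kx (proj1 (wdeg_wle a _ x) (leqnn _)).
by exists c.
Qed.

Lemma im_mx_nocol p r (G : 'M[S]_(p, r)) : r = 0%N -> im_mx G = [set 0].
Proof.
move=> r0; move: G; rewrite r0 => G.
apply/seteqP; split=> [_ [x _ <-]|_ ->]; last by exists 0; rewrite ?mulmx0.
by rewrite (flatmx0 x) mulmx0.
Qed.

(** Transport between equal twists and modules; the two proofs that the module is a submodule are
    identified by proof irrelevance. *)
Lemma minimal_gens_eq p r (a a' : 'I_p -> nat) (K K' : set 'cV[S]_p)
    (Ksub : submodule K) (Ksub' : submodule K') (G : 'M[S]_(p, r)) :
  a = a' -> K = K' -> minimal_gens a Ksub G -> minimal_gens a' Ksub' G.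
Proof.
move=> aa KK; case: a' / aa; case: K' / KK Ksub' => Ksub'.
by rewrite (Prop_irrelevance Ksub' Ksub).
Qed.

(** Rank, twist and module are bundled because their types change at every step; the tower is then a
    plain iteration of [ss_next]. *)
Record syzygy_stage := SyzygyStage {
  ss_rank : nat;
  ss_twist : 'I_ss_rank -> nat;
  ss_mod : set 'cV[S]_ss_rank;
  ss_sub : submodule ss_mod
}.

Definition ss_gens s := cid (minimal_gens_exist (ss_twist (s := s)) (ss_sub s)).

Definition ss_mx s : 'M[S]_(ss_rank s, projT1 (ss_gens s)) :=
  projT1 (cid (projT2 (ss_gens s))).

Lemma ss_mxP s : minimal_gens (ss_twist (s := s)) (ss_sub s) (ss_mx s).
Proof. exact: projT2 (cid (projT2 (ss_gens s))). Qed.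

Definition ss_next s : syzygy_stage :=
  SyzygyStage (coldeg (ss_twist (s := s)) (ss_mx s)) (submodule_ker (ss_mx s)).

Lemma syzygy_tower q (C : set 'cV[S]_q) (Csub : submodule C) :
  exists (p : nat -> nat) (A : forall k, 'M[S]_(rank_at q p k, rank_at q p k.+1))
    (a : forall k, 'I_(rank_at q p k) -> nat)
    (K : forall k, set 'cV[S]_(rank_at q p k)) (Ksub : forall k, submodule (K k)),
  [/\ a 0%N = fun=> 0%N, K 0%N = C, forall k, a k.+1 = coldeg (a k) (A k),
      forall k, K k.+1 = ker_mx (A k) & forall k, minimal_gens (a k) (Ksub k) (A k)].
Proof.
pose s k := iter k ss_next (SyzygyStage (fun=> 0%N) Csub).
pose p k := ss_rank (s k).
(* The case distinction lets [rank_at] compute: it is [q] at zero and [p k] at a successor. *)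
pose A k : 'M[S]_(rank_at q p k, rank_at q p k.+1) :=
  if k is k'.+1 then ss_mx (s k'.+1) else ss_mx (s 0%N).
pose a k : 'I_(rank_at q p k) -> nat :=
  if k is k'.+1 then ss_twist (s := s k'.+1) else ss_twist (s := s 0%N).
pose K k : set 'cV[S]_(rank_at q p k) :=
  if k is k'.+1 then ss_mod (s := s k'.+1) else ss_mod (s := s 0%N).
have Ksub k : submodule (K k) by case: k => [|k]; apply: ss_sub.
exists p, A, a, K, Ksub; split=> //; try by case.
by case=> [|k]; apply: minimal_gens_eq (ss_mxP _).
Qed.

End Resolution.

Theorem theorem2 (F : fieldType) (n q : nat) (C : set 'cV[{mpoly F[n]}]_q) :
  (0 < n)%N -> (0 < q)%N -> submodule C -> C <> [set 0] ->
  exists G : polycomplex F n q,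
    [/\ resolution_of G C, reduced G & minimal G].
Proof.
move=> n0 _ Csub C0.
have [p [A [a [K [Ksub [a0 K0 aS KS minA]]]]]] := syzygy_tower Csub.
have minS k : minimal_gens (coldeg (a k) (A k)) (submodule_ker (A k)) (A k.+1).
  by apply: minimal_gens_eq (minA k.+1).
have leadE k : ker_mx (lead_mx (a k) (a k.+1) (A k)) =
    im_mx (lead_mx (a k.+1) (a k.+2) (A k.+1)).
  by rewrite (aS k.+1) aS; apply: lead_exact (minA k) (minS k).
have exactA k : ker_mx (A k) = im_mx (A k.+1) by rewrite (minimal_gens_im (minS k)).
have pn : p n.+1 = 0%N.
  (* The stopping argument runs on the leading matrices, whose constant terms are controlled by
     [lead_mcoeff0]. *)
  apply: (minimal_exact_stop (p := rank_at q p) leadE n0) => -[//|k] i j _.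
  by rewrite (aS k.+1) aS; apply: lead_mcoeff0 (minA k) (minS k).
have exl : exists l, p l.+1 == 0%N by exists n; rewrite pn.
(* The least such [l] makes all ranks up to [l] positive, and it is not zero because [C] is
   nonzero. *)
case: (ex_minnP exl) => l /eqP pl lmin.
have CE : im_mx (A 0%N) = C by rewrite (minimal_gens_im (minA 0%N)).
have l0 : (0 < l)%N.
  rewrite lt0n; apply/eqP => l0; apply: C0; rewrite -CE im_mx_nocol //=.
  by rewrite l0 in pl.
have p0 k : (0 < k <= l)%N -> (0 < p k)%N.
  case: k => // k /= kl; rewrite lt0n; apply/negP => /lmin.
  by rewrite leqNgt kl.
have colA k : (k < l)%N -> forall j, col j (A k) != 0.
  by move=> _; case: (minA k).
have AA k : (k.+1 < l)%N -> A k *m A k.+1 = 0.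
  by move=> _; apply: mulmx_im_ker; rewrite exactA.
pose G := @Polycomplex F n q l p A l0 p0 colA AA.
have tabE k : @col_table _ _ _ G k = a k.
  by elim: k => [|k IH] /=; [rewrite a0|rewrite IH aS].
(* At the last place the next matrix has [p l.+1 = 0] columns, so its image is zero. This serves
   both the complex and its leading matrices. *)
have trunc (M : forall k, 'M[{mpoly F[n]}]_(rank_at q p k, rank_at q p k.+1)) :
    (forall k, ker_mx (M k) = im_mx (M k.+1)) -> exact_seq l M.
  move=> exM k kl; rewrite exM; case: ifP => // /negbT; rewrite -leqNgt => lk.
  by apply: im_mx_nocol; rewrite -pl; congr p; congr _.+1; apply/eqP; rewrite eqn_leq kl.
exists G; split.
- by split=> //; apply: trunc.
- apply: (trunc (@pc_lead _ _ _ G)) => k.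
  have leadG j : @pc_lead _ _ _ G j = lead_mx (a j) (a j.+1) (A j).
    by rewrite /pc_lead !tabE.
  by rewrite !leadG.
split.
  rewrite /pc_free !tabE aS.
  apply: minimal_gens_hom; apply: minimal_gens_eq (minA 0%N) => //.
  by rewrite (minimal_gens_im (minA 0%N)).
move=> k _; rewrite /pc_free !tabE aS; apply: minimal_gens_hom.
by apply: minimal_gens_eq (minS k).
Qed.
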